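(* Let $G$ be a group. In the braided strict monoidal category $\mathbf{TSpan}_G$, the object $G=G^1$ is a commutative Frobenius algebra with the following structure: $\nabla:G\otimes G\to G$ is the multiplication function of $G$ viewed as a span, i.e. $G\times G\xleftarrow{1}G\times G\xrightarrow{\,\cdot\,}G$; $n:I\to G$ is the function picking out the identity of $G$, viewed as a span; $\Delta:G\to G\otimes G$ is the opposite span of $\nabla$; and $e:G\to I$ is the opposite span of $n$.
   Context: Definition of $\mathbf{TSpan}_G$: the objects are the formal powers $G^n$ ($n\ge 0$) of $G$. An arrow from $G^m$ to $G^n$ is an isomorphism class of spans of sets $G^m\xleftarrow{\delta_0}S\xrightarrow{\delta_1}G^n$ such that there exists a function $G\times S\to S$, written $(g,s)\mapsto gs$, for which $s\mapsto gs$ is a bijection for each $g\in G$, and satisfying: 1) if $\delta_0(s)=(x_1,\dots,x_m)$ and $\delta_1(s)=(y_1,\dots,y_n)$ then $\delta_0(gs)=(x_1^g,\dots,x_m^g)$ and $\delta_1(gs)=(y_1^g,\dots,y_n^g)$ for all $g\in G$, where $x^g=gxg^{-1}$; 2) if $\delta_0(s)=(x_1,\dots,x_m)$ and $\delta_1(s)=(y_1,\dots,y_n)$ then $x_1\cdots x_m(y_1\cdots y_n)^{-1}\in Z(G)$, the center of $G$. Composition (by pullback) and identities are those of spans. $\mathbf{TSpan}_G$ is braided strict monoidal with $G^m\otimes G^n=G^{m+n}$, unit $I=G^0$ (the one-point set), tensor of arrows the product of spans, and twist $\tau_{m,n}$ the span given by the function $(x,y)\mapsto(y_1^{\overline{x}},\dots,y_n^{\overline{x}},x_1,\dots,x_m)$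 with $\overline{x}=x_1\cdots x_m$. The opposite of a span is obtained by interchanging its two legs. Commutative Frobenius algebra in a braided strict monoidal category with twist $\tau$ (composition written right to left): an object $G$ with arrows $\nabla:G\otimes G\to G$, $\Delta:G\to G\otimes G$, $n:I\to G$, $e:G\to I$ such that $(G,\nabla,n)$ is a monoid, $(G,\Delta,e)$ is a comonoid, $(1_G\otimes\nabla)(\Delta\otimes 1_G)=\Delta\nabla=(\nabla\otimes 1_G)(1_G\otimes\Delta)$, $\nabla\tau_{G,G}=\nabla$ and $\tau_{G,G}\Delta=\Delta$. *)

(* Defs.v *)
From mathcomp Require Import all_boot.
From mathcomp Require Import boolp.

Set Implicit Arguments.
Unset Strict Implicit.
Unset Printing Implicit Defensive.

(** * Braided strict monoidal categories *)

(* Strictness of the tensor is an equality between objects, so arrows have to be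
   transported along such equalities for the strict equations to typecheck. *)
Definition castHom (T : Type) (H : T -> T -> Type) (a a' b b' : T)
    (ea : a = a') (eb : b = b') (f : H a b) : H a' b' :=
  match ea in _ = x, eb in _ = y return H x y with erefl, erefl => f end.

(* Composition is written right to left: [compm g f] is f followed by g. *)
Record braidedStrictMonoidal := BraidedStrictMonoidal {
  ob :> Type;
  hom : ob -> ob -> Type;
  idm : forall a, hom a a;
  compm : forall a b c, hom b c -> hom a b -> hom a c;
  comp1m : forall a b (f : hom a b), compm (idm b) f = f;
  compm1 : forall a b (f : hom a b), compm f (idm a) = f;
  compmA : forall a b c d (h : hom c d) (g : hom b c) (f : hom a b),
    compm h (compm g f) = compm (compm h g) f;
  tens : ob -> ob -> ob;
  tunit : ob;
  tensA : forall a b c, tens a (tens b c) = tens (tens a b) c;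
  tens1l : forall a, tens tunit a = a;
  tensr1 : forall a, tens a tunit = a;
  tensm : forall a b c d, hom a b -> hom c d -> hom (tens a c) (tens b d);
  tensm_id : forall a b, tensm (idm a) (idm b) = idm (tens a b);
  tensm_comp : forall a b c a' b' c'
      (g : hom b c) (f : hom a b) (g' : hom b' c') (f' : hom a' b'),
    tensm (compm g f) (compm g' f') = compm (tensm g g') (tensm f f');
  tensmA : forall a b c a' b' c'
      (f : hom a a') (g : hom b b') (h : hom c c'),
    castHom (tensA a b c) (tensA a' b' c') (tensm f (tensm g h))
      = tensm (tensm f g) h;
  tensm1l : forall a b (f : hom a b),
    castHom (tens1l a) (tens1l b) (tensm (idm tunit) f) = f;
  tensmr1 : forall a b (f : hom a b),
    castHom (tensr1 a) (tensr1 b) (tensm f (idm tunit)) = f;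
  twist : forall a b, hom (tens a b) (tens b a);
  twist_iso : forall a b, exists u : hom (tens b a) (tens a b),
    compm u (twist a b) = idm _ /\ compm (twist a b) u = idm _;
  twist_nat : forall a b a' b' (f : hom a a') (g : hom b b'),
    compm (twist a' b') (tensm f g) = compm (tensm g f) (twist a b);
  twist_hexl : forall a b c,
    castHom (tensA a b c) (esym (tensA b c a)) (twist a (tens b c))
      = compm (castHom (tensA b a c) erefl (tensm (idm b) (twist a c)))
             (tensm (twist a b) (idm c));
  twist_hexr : forall a b c,
    castHom (esym (tensA a b c)) (tensA c a b) (twist (tens a b) c)
      = compm (castHom (esym (tensA a c b)) erefl (tensm (twist a c) (idm b)))
             (tensm (idm a) (twist b c))
}.

Arguments idm {b0} a.
Arguments tensA {b0} a b c.
Arguments tens1l {b0} a.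
Arguments tensr1 {b0} a.
Arguments tunit {b0}.

Declare Scope bsm_scope.
Delimit Scope bsm_scope with bsm.
Reserved Notation "g \oc f" (at level 50, left associativity).
Reserved Notation "f \ox g" (at level 40, left associativity).
Notation "g \oc f" := (compm g f) : bsm_scope.
Notation "f \ox g" := (tensm f g) : bsm_scope.

(** * Commutative Frobenius algebras *)

Section Frobenius.
Local Open Scope bsm_scope.
Variables (C : braidedStrictMonoidal) (A : C).
Local Notation "1" := (idm A).
Local Notation AA := (tens A A).
Local Notation assA := (tensA A A A).

Definition isMonoid (nabla : hom AA A) (n : hom tunit A) : Prop :=
  [/\ castHom assA erefl (nabla \oc (1 \ox nabla)) = nabla \oc (nabla \ox 1),
      castHom (tens1l A) erefl (nabla \oc (n \ox 1)) = 1
    & castHom (tensr1 A) erefl (nabla \oc (1 \ox n)) = 1].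

Definition isComonoid (Delta : hom A AA) (e : hom A tunit) : Prop :=
  [/\ castHom erefl assA ((1 \ox Delta) \oc Delta) = (Delta \ox 1) \oc Delta,
      castHom erefl (tens1l A) ((e \ox 1) \oc Delta) = 1
    & castHom erefl (tensr1 A) ((1 \ox e) \oc Delta) = 1].

Record isCommFrobenius (nabla : hom AA A) (n : hom tunit A)
    (Delta : hom A AA) (e : hom A tunit) : Prop := {
  frob_monoid : isMonoid nabla n;
  frob_comonoid : isComonoid Delta e;
  frob_left : castHom assA erefl (1 \ox nabla) \oc (Delta \ox 1)
    = Delta \oc nabla;
  frob_right : castHom (esym assA) erefl (nabla \ox 1) \oc (1 \ox Delta)
    = Delta \oc nabla;
  frob_comm : nabla \oc twist A A = nabla;
  frob_cocomm : twist A A \oc Delta = Delta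
}.

End Frobenius.

(** * Spans between powers of a group *)

Section Spans.
Local Open Scope group_scope.
Variable G : groupType.

(* x^g = g x g^-1, whereas the library's [x ^ g] is g^-1 x g. *)
Definition lconj (g x : G) : G := g * x * g^-1.

Definition central (z : G) : Prop := forall g : G, commute z g.

Definition prods (x : seq G) : G := \big[*%g/1]_(y <- x) y.

Record span (m n : nat) := Span {
  apex : Type;
  leg0 : apex -> m.-tuple G;
  leg1 : apex -> n.-tuple G
}.

Definition isoSpan m n (S T : span m n) : Prop :=
  exists f : apex S -> apex T, [/\ bijective f,
    forall s, leg0 (f s) = leg0 s & forall s, leg1 (f s) = leg1 s].

Definition isTSpan m n (S : span m n) : Prop :=
  exists act : G -> apex S -> apex S, [/\ forall g, bijective (act g),
    forall g (s : apex S), leg0 (act g s) = map_tuple (lconj g) (leg0 s)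
             /\ leg1 (act g s) = map_tuple (lconj g) (leg1 s)
  & forall s : apex S, central (prods (leg0 s) * (prods (leg1 s))^-1)].

Definition funSpan m n (f : m.-tuple G -> n.-tuple G) : span m n :=
  Span (fun x => x) f.

Definition oppSpan m n (S : span m n) : span n m := Span (@leg1 _ _ S) (@leg0 _ _ S).

Definition idSpan n : span n n := funSpan (fun x => x).

Definition compSpan m n p (T : span n p) (S : span m n) : span m p :=
  @Span m p {st : apex S * apex T | leg1 st.1 = leg0 st.2}
    (fun u => leg0 (sval u).1) (fun u => leg1 (sval u).2).

(* G^m x G^n is identified with G^(m+n) by concatenation of tuples, both in the
   product of spans and in the domain of the twist. *)
Definition tensSpan m n m' n' (S : span m n) (T : span m' n') :
    span (m + m') (n + n') :=
  @Span (m + m') (n + n') (apex S * apex T)%type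
    (fun st => cat_tuple (leg0 st.1) (leg0 st.2))
    (fun st => cat_tuple (leg1 st.1) (leg1 st.2)).

Definition twistSpan m n : span (m + n) (n + m) :=
  @Span (m + n) (n + m) (m.-tuple G * n.-tuple G)%type
    (fun xy => cat_tuple xy.1 xy.2)
    (fun xy => cat_tuple (map_tuple (lconj (prods xy.1)) xy.2) xy.1).

Definition mulSpan : span (1 + 1) 1 :=
  funSpan (fun x : 2.-tuple G => [tuple tnth x ord0 * tnth x ord_max]).

Definition unitSpan : span 0 1 := funSpan (fun _ : 0.-tuple G => [tuple 1]).

(** * The category TSpan *)

(* An arrow is an isomorphism class of spans, given as a predicate on spans.
   [isTSpan] is invariant under isomorphism, so asking it of one representative
   is asking it of the whole class. *)
Record arrow (m n : nat) := Arrow {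
  spanOf : span m n -> Prop;
  spanOfP : exists2 S, isTSpan S & forall T, spanOf T <-> isoSpan S T
}.

Lemma isoSpan_refl m n (S : span m n) : isoSpan S S.
Proof. by exists id; split=> //; exists id. Qed.

Lemma isoSpan_sym m n (S T : span m n) : isoSpan S T -> isoSpan T S.
Proof.
move=> [f [[g fK gK] f0 f1]]; exists g; split; first by exists f.
- by move=> t; rewrite -f0 gK.
- by move=> t; rewrite -f1 gK.
Qed.

Lemma isoSpan_trans m n (S T U : span m n) :
  isoSpan S T -> isoSpan T U -> isoSpan S U.
Proof.
move=> [f [bf f0 f1]] [g [bg g0 g1]]; exists (g \o f); split.
- exact: bij_comp.
- by move=> s /=; rewrite g0 f0.
- by move=> s /=; rewrite g1 f1.
Qed.

Lemma arrow_ext m n (f g : arrow m n) :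
  (forall S, spanOf f S <-> spanOf g S) -> f = g.
Proof.
case: f g => [f fP] [g gP] /= /predeqP efg; case: g / efg gP => gP.
by rewrite (Prop_irrelevance fP gP).
Qed.

Definition cls m n (S : span m n) (tS : isTSpan S) : arrow m n :=
  Arrow (ex_intro2 _ _ S tS (fun T => iff_refl (isoSpan S T))).

Lemma arrow_cls m n (f : arrow m n) : exists S (tS : isTSpan S), f = cls tS.
Proof.
case: (spanOfP f) => S tS fS; exists S, tS; exact: arrow_ext.
Qed.

Lemma cls_eq m n (S T : span m n) (tS : isTSpan S) (tT : isTSpan T) :
  isoSpan S T -> cls tS = cls tT.
Proof.
move=> iST; apply: arrow_ext => U /=; split; apply: isoSpan_trans => //.
exact: isoSpan_sym.
Qed.

Lemma prods_cat x y : prods (x ++ y) = prods x * prods y.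
Proof. exact: big_cat. Qed.

Lemma lconjM g : {morph lconj g : x y / x * y}.
Proof. by move=> x y; rewrite /lconj !mulgA mulgVK. Qed.

Lemma lconj1 g : lconj g 1 = 1.
Proof. by rewrite /lconj mulg1 mulgV. Qed.

Lemma lconj_mul g h x : lconj (g * h) x = lconj g (lconj h x).
Proof. by rewrite /lconj invgM !mulgA. Qed.

Lemma lconjK g : cancel (lconj g) (lconj g^-1).
Proof. by move=> x; rewrite -lconj_mul mulVg /lconj mul1g invg1 mulg1. Qed.

Lemma lconjVK g : cancel (lconj g^-1) (lconj g).
Proof. by move=> x; rewrite -lconj_mul mulgV /lconj mul1g invg1 mulg1. Qed.

Lemma prods_map g x : prods (map (lconj g) x) = lconj g (prods x).
Proof.
elim: x => [|y x IH] /=; first by rewrite /prods !big_nil lconj1.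
by rewrite /prods !big_cons in IH *; rewrite IH lconjM.
Qed.

Lemma lconj_central z g x : central z -> lconj (z * g) x = lconj g x.
Proof.
by move=> cz; rewrite lconj_mul {1}/lconj cz mulgK.
Qed.

Lemma lconjJ g h x : lconj (lconj g h) (lconj g x) = lconj g (lconj h x).
Proof. by rewrite -!lconj_mul /lconj mulgVK. Qed.

Lemma map_tuple_bij n g : bijective (@map_tuple n G G (lconj g)).
Proof.
exists (map_tuple (lconj g^-1)) => x; apply: val_inj => /=;
  by rewrite -map_comp map_id_in // => y _ /=; rewrite ?lconjK ?lconjVK.
Qed.

Lemma centralM y z : central y -> central z -> central (y * z).
Proof.
by move=> cy cz g; apply/commute_sym/commuteM; apply: commute_sym.
Qed.

Lemma centralV z : central z -> central z^-1.
Proof. by move=> cz g; apply/commute_sym/commuteV/commute_sym. Qed.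

Lemma central1 : central 1.
Proof. by move=> g; apply/commute_sym/commute1. Qed.

Lemma isTSpan_id n : isTSpan (idSpan n).
Proof.
exists (fun g => map_tuple (lconj g)); split=> //.
- exact: map_tuple_bij.
- by move=> s /=; rewrite mulgV; exact: central1.
Qed.

Definition pullPair m n p (T : span n p) (S : span m n) s t
    (e : leg1 s = leg0 t) : apex (compSpan T S) :=
  exist (fun st : apex S * apex T => leg1 st.1 = leg0 st.2) (s, t) e.

Lemma compSpan_eq m n p (T : span n p) (S : span m n)
  (u v : apex (compSpan T S)) : sval u = sval v -> u = v.
Proof. by case: u v => [u hu] [v hv] /= ?; apply: eq_exist. Qed.

Lemma isTSpan_comp m n p (T : span n p) (S : span m n) :
  isTSpan T -> isTSpan S -> isTSpan (compSpan T S).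
Proof.
move=> [b [bb bl bz]] [a [ab al az]].
have ex g (u : apex (compSpan T S)) :
    leg1 (a g (sval u).1) = leg0 (b g (sval u).2).
  by case: u => [[s t] /= e]; rewrite (al _ _).2 (bl _ _).1 e.
exists (fun g u => pullPair (ex g u)); split.
- move=> g; have [a' aK a'K] := ab g; have [b' bK b'K] := bb g.
  have ex' (u : apex (compSpan T S)) :
      leg1 (a' (sval u).1) = leg0 (b' (sval u).2).
    case: u => [[s t] /= e]; apply: (bij_inj (map_tuple_bij n g)).
    by rewrite -(al _ _).2 -(bl _ _).1 a'K b'K.
  exists (fun u => pullPair (ex' u)) => -[[s t] e]; apply: compSpan_eq => /=;
    by rewrite ?aK ?bK ?a'K ?b'K.
- by move=> g [[s t] e] /=; rewrite (al _ _).1 (bl _ _).2.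
- move=> [[s t] /= e]; have := centralM (az s) (bz t).
  by rewrite e mulgA mulgVK.
Qed.

Lemma isTSpan_tens m n m' n' (S : span m n) (T : span m' n') :
  isTSpan S -> isTSpan T -> isTSpan (tensSpan S T).
Proof.
move=> [a [ab al az]] [b [bb bl bz]].
exists (fun g st => (a g st.1, b g st.2)); split.
- move=> g; have [a' aK a'K] := ab g; have [b' bK b'K] := bb g.
  by exists (fun st => (a' st.1, b' st.2)) => -[s t] /=;
    rewrite ?aK ?bK ?a'K ?b'K.
- by move=> g [s t]; split; apply: val_inj => /=;
    rewrite map_cat ?(al _ _).1 ?(bl _ _).1 ?(al _ _).2 ?(bl _ _).2.
- move=> [s t] /=; rewrite !prods_cat invgM mulgA -(mulgA (prods (leg0 s))).
  have := centralM (bz t) (az s).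
  set x := prods (leg0 s); set y := prods (leg0 t); set x' := prods (leg1 s).
  set z := (y * _); move=> c.
  by rewrite -(bz t x) -mulgA.
Qed.

Lemma isTSpan_twist m n : isTSpan (twistSpan m n).
Proof.
exists (fun g xy => (map_tuple (lconj g) xy.1, map_tuple (lconj g) xy.2)); split.
- move=> g; have [a' aK a'K] := map_tuple_bij m g.
  have [b' bK b'K] := map_tuple_bij n g.
  by exists (fun st => (a' st.1, b' st.2)) => -[s t] /=;
    rewrite ?aK ?bK ?a'K ?b'K.
- move=> g [x y]; split; apply: val_inj => /=; rewrite map_cat //.
  congr (_ ++ _); rewrite prods_map -!map_comp; apply: eq_map => z /=.
  exact: lconjJ.
- move=> [x y] /=; rewrite !prods_cat prods_map /lconj mulgVK mulgV.
  exact: central1.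
Qed.

Lemma isTSpan_opp m n (S : span m n) : isTSpan S -> isTSpan (oppSpan S).
Proof.
move=> [a [ab al az]]; exists a; split=> //.
- by move=> g s /=; rewrite (al g s).1 (al g s).2.
- by move=> s /=; rewrite -invgF; apply: centralV.
Qed.

Lemma isoSpan_comp m n p (T T' : span n p) (S S' : span m n) :
  isoSpan T T' -> isoSpan S S' -> isoSpan (compSpan T S) (compSpan T' S').
Proof.
move=> [g [[g' gK g'K] g0 g1]] [f [[f' fK f'K] f0 f1]].
have e (u : apex (compSpan T S)) :
    leg1 (f (sval u).1) = leg0 (g (sval u).2).
  by case: u => [[s t] /= e]; rewrite f1 g0.
have e' (u : apex (compSpan T' S')) :
    leg1 (f' (sval u).1) = leg0 (g' (sval u).2).
  by case: u => [[s t] /= e']; rewrite -f1 -g0 f'K g'K.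
exists (fun u => pullPair (e u)); split.
- by exists (fun u => pullPair (e' u)) => -[[s t] h]; apply: compSpan_eq => /=;
    rewrite ?fK ?gK ?f'K ?g'K.
- by move=> u /=; rewrite f0.
- by move=> u /=; rewrite g1.
Qed.

Lemma isoSpan_tens m n m' n' (S S' : span m n) (T T' : span m' n') :
  isoSpan S S' -> isoSpan T T' -> isoSpan (tensSpan S T) (tensSpan S' T').
Proof.
move=> [f [[f' fK f'K] f0 f1]] [g [[g' gK g'K] g0 g1]].
exists (fun st => (f st.1, g st.2)); split.
- by exists (fun st => (f' st.1, g' st.2)) => -[s t] /=;
    rewrite ?fK ?gK ?f'K ?g'K.
- by move=> [s t] /=; rewrite f0 g0.
- by move=> [s t] /=; rewrite f1 g1.
Qed.

Definition idArrow n : arrow n n := cls (isTSpan_id n).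

Definition twistArrow m n : arrow (m + n) (n + m) := cls (isTSpan_twist m n).

Lemma compArrowP m n p (g : arrow n p) (f : arrow m n) :
  exists2 U, isTSpan U & forall V,
    (exists T S, [/\ spanOf g T, spanOf f S & isoSpan (compSpan T S) V])
      <-> isoSpan U V.
Proof.
have [S [tS ->]] := arrow_cls f; have [T [tT ->]] := arrow_cls g.
exists (compSpan T S); first exact: isTSpan_comp.
move=> V /=; split=> [[T' [S' [iT iS]]]|iV].
- by apply: isoSpan_trans; apply: isoSpan_comp.
- by exists T, S; split=> //; apply: isoSpan_refl.
Qed.

Definition compArrow m n p (g : arrow n p) (f : arrow m n) : arrow m p :=
  Arrow (compArrowP g f).

Lemma tensArrowP m n m' n' (f : arrow m n) (g : arrow m' n') :
  exists2 U, isTSpan U & forall V,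
    (exists S T, [/\ spanOf f S, spanOf g T & isoSpan (tensSpan S T) V])
      <-> isoSpan U V.
Proof.
have [S [tS ->]] := arrow_cls f; have [T [tT ->]] := arrow_cls g.
exists (tensSpan S T); first exact: isTSpan_tens.
move=> V /=; split=> [[S' [T' [iS iT]]]|iV].
- by apply: isoSpan_trans; apply: isoSpan_tens.
- by exists S, T; split=> //; apply: isoSpan_refl.
Qed.

Definition tensArrow m n m' n' (f : arrow m n) (g : arrow m' n') :
  arrow (m + m') (n + n') := Arrow (tensArrowP f g).

Lemma compArrow_cls m n p (T : span n p) (S : span m n)
    (tT : isTSpan T) (tS : isTSpan S) :
  compArrow (cls tT) (cls tS) = cls (isTSpan_comp tT tS).
Proof.
apply: arrow_ext => V /=; split=> [[T' [S' [iT iS]]]|iV].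
- by apply: isoSpan_trans; apply: isoSpan_comp.
- by exists T, S; split=> //; apply: isoSpan_refl.
Qed.

Lemma tensArrow_cls m n m' n' (S : span m n) (T : span m' n')
    (tS : isTSpan S) (tT : isTSpan T) :
  tensArrow (cls tS) (cls tT) = cls (isTSpan_tens tS tT).
Proof.
apply: arrow_ext => V /=; split=> [[S' [T' [iS iT]]]|iV].
- by apply: isoSpan_trans; apply: isoSpan_tens.
- by exists S, T; split=> //; apply: isoSpan_refl.
Qed.

Definition castSpan m n m' n' (em : m = m') (en : n = n') (S : span m n) :
    span m' n' :=
  Span (fun s : apex S => tcast em (leg0 s)) (fun s => tcast en (leg1 s)).

Lemma isTSpan_cast m n m' n' (em : m = m') (en : n = n') (S : span m n) :
  isTSpan S -> isTSpan (castSpan em en S).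
Proof.
by case: S => X l0 l1; case: m' / em; case: n' / en.
Qed.

Lemma castHom_cls m n m' n' (em : m = m') (en : n = n') (S : span m n)
    (tS : isTSpan S) :
  castHom em en (cls tS) = cls (isTSpan_cast em en tS).
Proof.
by case: m' / em; case: n' / en; apply: cls_eq; exists id; split=> //; exists id.
Qed.

Lemma val_tcast m n (e : m = n) (t : m.-tuple G) : tcast e t = t :> seq G.
Proof. by case: n / e. Qed.

Lemma inj_surj_bij (X Y : Type) (f : X -> Y) :
  injective f -> (forall y, exists x, f x = y) -> bijective f.
Proof.
move=> fI fS; exists (fun y => sval (cid (fS y))) => [x|y];
  by [apply: fI; case: cid | case: cid].
Qed.

Lemma cat_tuple_inj m n (x x' : m.-tuple G) (y y' : n.-tuple G) :
  x ++ y = x' ++ y' :> seq G -> x = x' /\ y = y'.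
Proof.
move=> /eqP; rewrite eqseq_cat ?size_tuple // => /andP[/eqP ex /eqP ey].
by split; apply: val_inj.
Qed.

Lemma cat_tuple_surj m n (z : (m + n).-tuple G) :
  exists (x : m.-tuple G) (y : n.-tuple G), z = cat_tuple x y.
Proof.
have hx : size (take m z) == m by rewrite size_takel // size_tuple leq_addr.
have hy : size (drop m z) == n by rewrite size_drop size_tuple addKn.
by exists (Tuple hx), (Tuple hy); apply: val_inj; rewrite /= cat_take_drop.
Qed.

Lemma compA_span m n p q (U : span p q) (T : span n p) (S : span m n) :
  isoSpan (compSpan U (compSpan T S)) (compSpan (compSpan U T) S).
Proof.
have e (w : apex (compSpan U (compSpan T S))) :
    leg1 (sval (sval w).1).2 = leg0 (sval w).2 by case: w => [[[[s t] h] u] k].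
have k (w : apex (compSpan U (compSpan T S))) :
    leg1 (sval (sval w).1).1 = leg0 (pullPair (e w)).
  by case: w (e w) => [[[[s t] h] u] k].
exists (fun w => pullPair (k w)); split=> //; apply: inj_surj_bij.
- move=> w w' /(congr1 sval)[e1 e2 e3]; apply: compSpan_eq.
  case: w {e k} e1 e2 e3 => [[w u] h]; case: w' => [[w' u'] h'] /=.
  move=> e1 e2 ->; congr (_, _); apply: compSpan_eq.
  by case: w {h} e1 e2 => [[s t] h]; case: w' {h'} => [[s' t'] h'] /= -> ->.
- move=> [[s [[t u] /= h]] /= h'].
  exists (pullPair (h : leg1 (pullPair h' : apex (compSpan T S)) = leg0 u)).
  apply: (@compSpan_eq _ _ _ (compSpan U T) S); congr (_, _).
  by apply: (@compSpan_eq _ _ _ U T).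
Qed.

Lemma comp1m_span m n (S : span m n) : isoSpan (compSpan (idSpan n) S) S.
Proof.
exists (fun u => (sval u).1); split=> //; last by case=> -[s t].
apply: inj_surj_bij => [[[s t] /= h] [[s' t'] /= h'] e|s].
- by apply: eq_exist; rewrite /= -h -h' e.
- by exists (pullPair (erefl : leg1 s = leg0 (leg1 s : apex (idSpan n)))).
Qed.

Lemma compm1_span m n (S : span m n) : isoSpan (compSpan S (idSpan m)) S.
Proof.
exists (fun u => (sval u).2); split=> //; last by case=> -[s t].
apply: inj_surj_bij => [[[s t] /= h] [[s' t'] /= h'] e|s].
- by apply: eq_exist; rewrite /= h h' e.
- by exists (pullPair (erefl : leg1 (leg0 s : apex (idSpan m)) = leg0 s)).
Qed.

Lemma tens_id_span m n : isoSpan (tensSpan (idSpan m) (idSpan n)) (idSpan (m + n)).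
Proof.
exists (fun u => cat_tuple u.1 u.2); split=> //.
apply: inj_surj_bij => [[x y] [x' y'] /= /(congr1 val)/cat_tuple_inj[-> ->] //|z].
by have [x [y ->]] := cat_tuple_surj z; exists (x, y).
Qed.

Lemma tens_comp_span m n p m' n' p' (T : span n p) (S : span m n)
    (T' : span n' p') (S' : span m' n') :
  isoSpan (tensSpan (compSpan T S) (compSpan T' S'))
          (compSpan (tensSpan T T') (tensSpan S S')).
Proof.
have e (w : apex (tensSpan (compSpan T S) (compSpan T' S'))) :
    leg1 (((sval w.1).1, (sval w.2).1) : apex (tensSpan S S'))
      = leg0 (((sval w.1).2, (sval w.2).2) : apex (tensSpan T T')).
  by case: w => [[[s t] /= h] [[s' t'] /= h']]; rewrite h h'.
exists (fun w => pullPair (e w)); split=> //; apply: inj_surj_bij.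
- move=> [u v] [u' v'] /(congr1 sval)[/= e1 e2 e3 e4].
  by congr (_, _); apply: compSpan_eq; apply: injective_projections.
- move=> [[[s s'] [t t']] /= h].
  have [h1 h2] := cat_tuple_inj (congr1 val h).
  by exists (pullPair h1, pullPair h2); apply: eq_exist.
Qed.

Lemma tensA_span m n p m' n' p' (S : span m m') (T : span n n') (U : span p p') :
  isoSpan (castSpan (addnA m n p) (addnA m' n' p') (tensSpan S (tensSpan T U)))
          (tensSpan (tensSpan S T) U).
Proof.
exists (fun w : apex S * (apex T * apex U) => (w.1, w.2.1, w.2.2)); split.
- by exists (fun w => (w.1.1, (w.1.2, w.2))); [case=> s [] | case=> -[]].
- by move=> w; apply: val_inj; rewrite /= val_tcast /= catA.
- by move=> w; apply: val_inj; rewrite /= val_tcast /= catA.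
Qed.

Lemma tens1l_span m n (S : span m n) :
  isoSpan (castSpan (add0n m) (add0n n) (tensSpan (idSpan 0) S)) S.
Proof.
exists (fun w : 0.-tuple G * apex S => w.2); split.
- by exists (fun s => ([tuple], s)) => // -[x s] /=; rewrite (tuple0 x).
- by move=> w; apply: val_inj; rewrite /= val_tcast /= (tuple0 w.1).
- by move=> w; apply: val_inj; rewrite /= val_tcast /= (tuple0 w.1).
Qed.

Lemma tensr1_span m n (S : span m n) :
  isoSpan (castSpan (addn0 m) (addn0 n) (tensSpan S (idSpan 0))) S.
Proof.
exists (fun w : apex S * 0.-tuple G => w.1); split.
- by exists (fun s => (s, [tuple])) => // -[s x] /=; rewrite (tuple0 x).
- by move=> w; apply: val_inj; rewrite /= val_tcast /= (tuple0 w.2) /= cats0.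
- by move=> w; apply: val_inj; rewrite /= val_tcast /= (tuple0 w.2) /= cats0.
Qed.

Lemma comp_opp_span m n (S : span m n) : bijective (@leg0 _ _ S) ->
  injective (@leg1 _ _ S) -> isoSpan (compSpan (oppSpan S) S) (idSpan m).
Proof.
move=> [l lK Kl] l1I; exists (fun u => leg0 (sval u).1); split=> //.
- apply: inj_surj_bij => [[[s t] /= h] [[s' t'] /= h'] /(can_inj lK) e|x].
    by apply: eq_exist; rewrite /= -(l1I _ _ h) -(l1I _ _ h') e.
  by exists (pullPair (erefl : leg1 (l x) = leg0 (l x : apex (oppSpan S)))) => /=.
- by case=> -[s t] /= h; rewrite (l1I _ _ h).
Qed.

Lemma twist_bij0 m n : bijective (@leg0 _ _ (twistSpan m n)).
Proof.
apply: inj_surj_bij => [[x y] [x' y'] /= /(congr1 val)/cat_tuple_inj[-> ->] //|z].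
by have [x [y ->]] := cat_tuple_surj z; exists (x, y).
Qed.

Lemma twist_bij1 m n : bijective (@leg1 _ _ (twistSpan m n)).
Proof.
apply: inj_surj_bij => [[x y] [x' y'] /= /(congr1 val)/cat_tuple_inj[e ex]|z].
  by rewrite ex in e *; rewrite (bij_inj (map_tuple_bij _ _) e).
have [y [x ->]] := cat_tuple_surj z.
have [f _ fK] := map_tuple_bij n (prods x).
by exists (x, f y) => /=; rewrite fK.
Qed.

Lemma map_lconj_central m (g h : G) (x : m.-tuple G) : central (g * h^-1) ->
  map_tuple (lconj g) x = map_tuple (lconj h) x.
Proof.
move=> c; apply: eq_from_tnth => i; rewrite !tnth_map.
by rewrite -[g](mulgVK h) lconj_central.
Qed.

Lemma twist_nat_span m n m' n' (S : span m m') (T : span n n') :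
  isTSpan S -> isTSpan T ->
  isoSpan (compSpan (tensSpan T S) (twistSpan m n))
          (compSpan (twistSpan m' n') (tensSpan S T)).
Proof.
move=> [_ [_ _ az]] [b [bb bl _]].
apply: isoSpan_sym.
have e (w : apex (compSpan (twistSpan m' n') (tensSpan S T))) :
    leg1 ((leg0 (sval w).1.1, leg0 (sval w).1.2) : apex (twistSpan m n))
    = leg0 ((b (prods (leg0 (sval w).1.1)) (sval w).1.2, (sval w).1.1)
             : apex (tensSpan T S)).
  by rewrite /= (bl _ _).1.
exists (fun w => pullPair (e w)); split=> //.
- apply: inj_surj_bij.
  + move=> [[[s t] [x y]] /= h] [[[s' t'] [x' y']] /= h'].
    move=> /(congr1 sval)[_ _ /= e1 e2].
    rewrite -{}e2 {s'} in h' e1 *.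
    have et := bij_inj (bb _) e1.
    rewrite -{}et {e1 t'} in h' *; apply: eq_exist => /=.
    have [<- <-] := cat_tuple_inj (congr1 val h).
    by have [<- <-] := cat_tuple_inj (congr1 val h').
  + move=> [[[x y] [t s]] /= h].
    have [h1 h2] := cat_tuple_inj (congr1 val h).
    have [b' bK b'K] := bb (prods (leg0 s)).
    pose t0 := b' t.
    have k : leg1 ((s, t0) : apex (tensSpan S T))
             = leg0 ((leg1 s, leg1 t0) : apex (twistSpan m' n')) by [].
    exists (pullPair k); apply: eq_exist => /=.
    rewrite /t0 b'K -h2; congr (_, _, _).
    apply: (bij_inj (map_tuple_bij n (prods x))).
    by rewrite h1 h2 -(bl _ _).1 b'K.
- move=> [[[s t] [x y]] /= h].
  have [<- <-] := cat_tuple_inj (congr1 val h).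
  rewrite (bl _ _).2; congr cat_tuple; exact: map_lconj_central.
Qed.

Lemma twist_hexl_span m n p :
  isoSpan
    (compSpan (castSpan (addnA n m p) erefl
                 (tensSpan (idSpan n) (twistSpan m p)))
              (tensSpan (twistSpan m n) (idSpan p)))
    (castSpan (addnA m n p) (esym (addnA n p m)) (twistSpan m (n + p))).
Proof.
exists (fun w => ((sval w).1.1.1, cat_tuple (sval w).1.1.2 (sval w).1.2)).
split.
- apply: inj_surj_bij.
  + move=> [[[[x y] z] [y1 [x1 z1]]] /= h] [[[[x' y'] z'] [y1' [x1' z1']]] /= h'].
    move=> [ex /cat_tuple_inj[/= ey ez]]; apply: eq_exist => /=.
    move: h h' => /(congr1 val)/=; rewrite val_tcast /= catA.
    move=> /(@cat_tuple_inj (n + m) p (cat_tuple _ _) (cat_tuple _ _) z z1).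
    move=> [/(congr1 val)/cat_tuple_inj[<- <-] <-].
    move=> /(congr1 val)/=; rewrite val_tcast /= catA.
    move=> /(@cat_tuple_inj (n + m) p (cat_tuple _ _) (cat_tuple _ _) z' z1').
    move=> [/(congr1 val)/cat_tuple_inj[<- <-] <-].
    by rewrite ex ey ez.
  + move=> [x yz]; have [y [z ->]] := cat_tuple_surj yz.
    pose A := tensSpan (twistSpan m n) (idSpan p).
    pose B := castSpan (addnA n m p) erefl (tensSpan (idSpan n) (twistSpan m p)).
    have k : leg1 ((x, y, z) : apex A)
      = leg0 ((map_tuple (lconj (prods x)) y, (x, z)) : apex B).
      by apply: val_inj; rewrite /= val_tcast /= catA.
    by exists (pullPair k).
- move=> [[[[x y] z] [y1 [x1 z1]]] h]; apply: val_inj.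
  by rewrite /= val_tcast /= catA.
- move=> [[[[x y] z] [y1 [x1 z1]]] /= h]; apply: val_inj.
  rewrite /= val_tcast /= map_cat.
  move: h => /(congr1 val)/=; rewrite val_tcast /= catA.
  move=> /(@cat_tuple_inj (n + m) p (cat_tuple _ _) (cat_tuple _ _) z z1).
  move=> [/(congr1 val)/cat_tuple_inj[<- <-] <-].
  by rewrite catA.
Qed.

Lemma twist_hexr_span m n p :
  isoSpan
    (compSpan (castSpan (esym (addnA m p n)) erefl
                 (tensSpan (twistSpan m p) (idSpan n)))
              (tensSpan (idSpan m) (twistSpan n p)))
    (castSpan (esym (addnA m n p)) (addnA p m n) (twistSpan (m + n) p)).
Proof.
exists (fun w => (cat_tuple (sval w).1.1 (sval w).1.2.1, (sval w).1.2.2)).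
split.
- apply: inj_surj_bij.
  + move=> [[[x [y z]] [[x1 z1] y1]] /= h] [[[x' [y' z']] [[x1' z1'] y1']] /= h'].
    move=> [/cat_tuple_inj[/= ex ey] ez]; apply: eq_exist => /=.
    move: h h' => /(congr1 val)/=; rewrite val_tcast /= -catA.
    move=> /(@cat_tuple_inj m (p + n) x x1 (cat_tuple _ _) (cat_tuple _ _)).
    move=> [<- /(congr1 val)/cat_tuple_inj[<- <-]].
    move=> /(congr1 val)/=; rewrite val_tcast /= -catA.
    move=> /(@cat_tuple_inj m (p + n) x' x1' (cat_tuple _ _) (cat_tuple _ _)).
    move=> [<- /(congr1 val)/cat_tuple_inj[<- <-]].
    by rewrite ex ey ez.
  + move=> [xy z]; have [x [y ->]] := cat_tuple_surj xy.
    pose A := tensSpan (idSpan m) (twistSpan n p).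
    pose B := castSpan (esym (addnA m p n)) erefl
                (tensSpan (twistSpan m p) (idSpan n)).
    have k : leg1 ((x, (y, z)) : apex A)
      = leg0 ((x, map_tuple (lconj (prods y)) z, y) : apex B).
      by apply: val_inj; rewrite /= val_tcast /= catA.
    by exists (pullPair k).
- move=> [[[x [y z]] [[x1 z1] y1]] h]; apply: val_inj.
  by rewrite /= val_tcast /= catA.
- move=> [[[x [y z]] [[x1 z1] y1]] /= h]; apply: val_inj.
  rewrite /= val_tcast /=.
  move: h => /(congr1 val)/=; rewrite val_tcast /= -catA.
  move=> /(@cat_tuple_inj m (p + n) x x1 (cat_tuple _ _) (cat_tuple _ _)).
  move=> [<- /(congr1 val)/cat_tuple_inj[<- <-]].
  rewrite -catA -map_comp prods_cat; congr (_ ++ _).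
  by apply: eq_map => g /=; rewrite lconj_mul.
Qed.

End Spans.

Ltac toSpans :=
  rewrite /idArrow /twistArrow
    !(castHom_cls, compArrow_cls, tensArrow_cls);
  apply: cls_eq.

Program Definition TSpan (G : groupType) : braidedStrictMonoidal :=
  {| ob := nat;
     hom := @arrow G;
     idm := @idArrow G;
     compm := @compArrow G;
     tens := addn;
     tunit := 0%N;
     tensA := addnA;
     tens1l := add0n;
     tensr1 := addn0;
     tensm := @tensArrow G;
     twist := @twistArrow G |}.
Next Obligation.
have [S [tS ->]] := arrow_cls f; toSpans; exact: comp1m_span.
Qed.
Next Obligation.
have [S [tS ->]] := arrow_cls f; toSpans; exact: compm1_span.
Qed.
Next Obligation.
have [S [tS ->]] := arrow_cls f; have [T [tT ->]] := arrow_cls g.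
have [U [tU ->]] := arrow_cls h; toSpans; exact: compA_span.
Qed.
Next Obligation. by toSpans; exact: tens_id_span. Qed.
Next Obligation.
have [S [tS ->]] := arrow_cls f; have [T [tT ->]] := arrow_cls g.
have [S' [tS' ->]] := arrow_cls f'; have [T' [tT' ->]] := arrow_cls g'.
toSpans; exact: tens_comp_span.
Qed.
Next Obligation.
have [S [tS ->]] := arrow_cls f; have [T [tT ->]] := arrow_cls g.
have [U [tU ->]] := arrow_cls h; toSpans; exact: tensA_span.
Qed.
Next Obligation.
have [S [tS ->]] := arrow_cls f; toSpans; exact: tens1l_span.
Qed.
Next Obligation.
have [S [tS ->]] := arrow_cls f; toSpans; exact: tensr1_span.
Qed.
Next Obligation.
exists (cls (isTSpan_opp (isTSpan_twist G a b))); split; toSpans.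
- exact: (comp_opp_span (twist_bij0 G a b) (bij_inj (twist_bij1 G a b))).
- exact: (@comp_opp_span _ _ _ (oppSpan (twistSpan G a b))
            (twist_bij1 G a b) (bij_inj (twist_bij0 G a b))).
Qed.
Next Obligation.
have [S [tS ->]] := arrow_cls f; have [T [tT ->]] := arrow_cls g.
by toSpans; apply/isoSpan_sym/twist_nat_span.
Qed.
Next Obligation. by toSpans; apply/isoSpan_sym/twist_hexl_span. Qed.
Next Obligation. by toSpans; apply/isoSpan_sym/twist_hexr_span. Qed.

(* Main.v *)
Require Import Defs.
From mathcomp Require Import all_boot.
From mathcomp Require Import boolp.

Set Implicit Arguments.
Unset Strict Implicit.
Unset Printing Implicit Defensive.

(** Call a span a product-preserving map if its left leg is bijective (so that it
is the span of a function) and the function preserves the total product of a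
tuple. These spans are closed under composition and tensor, and contain the
identities, the multiplication, the unit and the twist. Since a 1-tuple is
determined by its product, there is at most one of them from G^m to G, so all
monoid laws and commutativity hold at once. The comonoid laws are the opposites
of the monoid laws, and cocommutativity is the opposite of commutativity because
the twist is unitary. For the Frobenius law, both sides are the span of all pairs
(p, q) of elements of G^2 with the same product; the second Frobenius law is the
opposite of the first. *)

Section SpanCalculus.
Variable G : groupType.

Lemma isoSpan_opp m n (S T : span G m n) :
  isoSpan S T -> isoSpan (oppSpan S) (oppSpan T).
Proof. by case=> f [bf f0 f1]; exists f. Qed.

Lemma opp_comp_span m n p (T : span G n p) (S : span G m n) :
  isoSpan (oppSpan (compSpan T S)) (compSpan (oppSpan S) (oppSpan T)).
Proof.
pose swap (u : apex (compSpan T S)) : apex (compSpan (oppSpan S) (oppSpan T)) :=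
  @pullPair _ _ _ _ (oppSpan S) (oppSpan T) _ _ (esym (svalP u)).
pose back (u : apex (compSpan (oppSpan S) (oppSpan T))) : apex (compSpan T S) :=
  @pullPair _ _ _ _ T S _ _ (esym (svalP u)).
exists swap; split=> //; exists back => -[[s t] h]; exact: compSpan_eq.
Qed.

Lemma isoSpan_cast m n m' n' (em : m = m') (en : n = n') (S T : span G m n) :
  isoSpan S T -> isoSpan (castSpan em en S) (castSpan em en T).
Proof. by case=> f [bf f0 f1]; exists f; split=> // s /=; rewrite ?f0 ?f1. Qed.

(** Turns a monoid law into the matching comonoid law. The two casts change places because the
    opposite exchanges source and target. *)
Lemma isoSpan_opp_cast_comp m n p m' p' (em : m = m') (ep : p = p')
    (T : span G n p) (S : span G m n) (U : span G m' p') :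
  isoSpan (castSpan em ep (compSpan T S)) U ->
  isoSpan (castSpan ep em (compSpan (oppSpan S) (oppSpan T))) (oppSpan U).
Proof.
move=> iU; apply: isoSpan_trans _ (isoSpan_opp iU).
exact: isoSpan_cast (isoSpan_sym (opp_comp_span T S)).
Qed.

(** Moves a reassociation of the middle object from the outer factor to the inner one, where taking
    the opposite of the first Frobenius law puts it. *)
Lemma comp_cast_span m n n' p (e : n = n') (T : span G n' p) (S : span G m n) :
  isoSpan (compSpan (castSpan (esym e) erefl T) S)
          (compSpan T (castSpan erefl e S)).
Proof. by case: n' / e T => T; exact: isoSpan_refl. Qed.

(** The opposite is contravariant, so S'^op = tau^op S^op, and tau tau^op = 1 since both legs of the
    twist are bijective. *)
Lemma twist_comp_opp m n p (S : span G (m + n) p) (S' : span G (n + m) p) :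
  isoSpan (compSpan S (twistSpan G n m)) S' ->
  isoSpan (compSpan (twistSpan G n m) (oppSpan S')) (oppSpan S).
Proof.
set tau := twistSpan G n m => /isoSpan_sym/isoSpan_opp iS.
apply: isoSpan_trans (isoSpan_comp (isoSpan_refl tau)
  (isoSpan_trans iS (opp_comp_span _ _))) _.
apply: isoSpan_trans (compA_span _ _ _) _.
apply: isoSpan_trans _ (comp1m_span _).
apply: isoSpan_comp (isoSpan_refl _).
exact: (@comp_opp_span _ _ _ (oppSpan tau)
          (twist_bij1 G n m) (bij_inj (twist_bij0 G n m))).
Qed.

End SpanCalculus.

Section ProductPreserving.
Local Open Scope group_scope.
Variable G : groupType.

Definition prodPreserving m n (S : span G m n) : Prop :=
  bijective (@leg0 _ _ _ S) /\ forall s : apex S, prods (leg1 s) = prods (leg0 s).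

Lemma prods1 (x : G) : prods [:: x] = x.
Proof. exact: big_seq1. Qed.

Lemma tuple1_prods (x : 1.-tuple G) : x = [tuple prods x].
Proof.
by case/tupleP: x => a x; apply: val_inj; rewrite (tuple0 x) /= prods1.
Qed.

Lemma prodPreserving_iso m (S T : span G m 1) :
  prodPreserving S -> prodPreserving T -> isoSpan S T.
Proof.
move=> [[s sK Ks] pS] [[t tK Kt] pT]; exists (t \o @leg0 _ _ _ S); split.
- by exists (s \o @leg0 _ _ _ T) => x /=; rewrite ?Kt ?Ks ?sK ?tK.
- by move=> x /=; rewrite Kt.
- by move=> x; rewrite [LHS]tuple1_prods [RHS]tuple1_prods pT pS /= Kt.
Qed.

Lemma prodPreserving_id n : prodPreserving (idSpan G n).
Proof. by split=> //; exists id. Qed.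

Lemma prodPreserving_mul : prodPreserving (mulSpan G).
Proof.
split; first by exists id.
move=> x /=; case/tupleP: x => a x; case/tupleP: x => b x.
by rewrite (tuple0 x) prods1 /prods /= !big_cons big_nil mulg1.
Qed.

Lemma prodPreserving_unit : prodPreserving (unitSpan G).
Proof.
split; first by exists id.
by move=> x /=; rewrite (tuple0 x) prods1 /prods big_nil.
Qed.

(** If a and b are the products of x and y, the twisted tuple has product (a b a^-1) a = a b. *)
Lemma prodPreserving_twist m n : prodPreserving (twistSpan G m n).
Proof.
split; first exact: twist_bij0.
by move=> [x y] /=; rewrite !prods_cat prods_map /lconj mulgVK.
Qed.

Lemma prodPreserving_comp m n p (T : span G n p) (S : span G m n) :
  prodPreserving T -> prodPreserving S -> prodPreserving (compSpan T S).
Proof.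
move=> [[t tK Kt] pT] [[s sK Ks] pS]; split; last first.
  by case=> -[x y] /= h; rewrite pT -h pS.
apply: inj_surj_bij => [[[x y] /= h] [[x' y'] /= h'] e|x].
  have ex := can_inj sK e; rewrite ex in h *.
  by apply: eq_exist; rewrite /= (can_inj tK (etrans (esym h) h')).
by exists (pullPair (esym (Kt (leg1 (s x))))) => /=.
Qed.

Lemma prodPreserving_tens m n m' n' (S : span G m n) (T : span G m' n') :
  prodPreserving S -> prodPreserving T -> prodPreserving (tensSpan S T).
Proof.
move=> [[s sK Ks] pS] [[t tK Kt] pT]; split; last first.
  by case=> x y /=; rewrite !prods_cat pS pT.
apply: inj_surj_bij => [[x y] [x' y'] /= /(congr1 val)|z].
  by case/cat_tuple_inj => /(can_inj sK) -> /(can_inj tK) ->.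
by have [x [y ->]] := cat_tuple_surj z; exists (s x, t y); rewrite /= Ks Kt.
Qed.

Lemma prodPreserving_cast m n m' n' (em : m = m') (en : n = n')
    (S : span G m n) : prodPreserving S -> prodPreserving (castSpan em en S).
Proof. by case: S => X l0 l1; case: m' / em; case: n' / en. Qed.

End ProductPreserving.

Ltac prodPreservingTac :=
  repeat first [ exact: prodPreserving_id | exact: prodPreserving_mul
    | exact: prodPreserving_unit | exact: prodPreserving_twist
    | apply: prodPreserving_cast | apply: prodPreserving_comp
    | apply: prodPreserving_tens ].

Section Frobenius.
Local Open Scope group_scope.
Variable G : groupType.
Local Notation M := (mulSpan G).
Local Notation I := (idSpan G 1).

Lemma isTSpan_mul : isTSpan M.
Proof.
exists (fun g => map_tuple (lconj g)); split.
- exact: map_tuple_bij.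
- move=> g s; split=> //; apply: val_inj.
  by rewrite /= !tnth_map lconjM.
- move=> s; rewrite (prodPreserving_mul G).2 mulgV; exact: central1.
Qed.

Lemma isTSpan_unit : isTSpan (unitSpan G).
Proof.
exists (fun g => map_tuple (lconj g)); split.
- exact: map_tuple_bij.
- by move=> g s; split=> //; apply: val_inj; rewrite /= lconj1.
- move=> s; rewrite (prodPreserving_unit G).2 mulgV; exact: central1.
Qed.

Lemma mul_prods (x : 2.-tuple G) : tnth x ord0 * tnth x ord_max = prods x.
Proof. by rewrite -[LHS]prods1 ((prodPreserving_mul G).2 x). Qed.

(** A point of the left apex amounts to a triple (u, v, w), with legs (u v, w) and (u, v w). The
    isomorphism sends it to this pair of legs, from which u, w and v = u^-1 (u v) can be read
    off. *)
Lemma frob_left_span :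
  isoSpan (compSpan (castSpan (addnA 1%N 1%N 1%N) erefl (tensSpan I M))
                    (tensSpan (oppSpan M) I))
          (compSpan (oppSpan M) M).
Proof.
set L := compSpan _ _.
have e (w : apex L) : leg1 (leg0 w : apex M) = leg0 (leg1 w : apex (oppSpan M)).
  apply: val_inj => /=; rewrite !mul_prods; congr [:: _].
  case: w => [[[x z] [a y]] /= h].
  (* Both sides reduce to the product of the middle triple, which [h] writes as [x] followed by [z]
     and as [a] followed by [y]. *)
  rewrite -cat1s !prods_cat !prods1 -!prods_cat.
  by move: h => /(congr1 val)/=; rewrite val_tcast /= => ->.
exists (fun w => pullPair (e w)); split=> //; apply: inj_surj_bij.
- move=> [[[x z] [a y]] /= h] [[[x' z'] [a' y']] /= h'] /(congr1 sval)[].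
  move=> ex ez /(@cat_tuple_inj _ 1 1 a a' [tuple _] [tuple _])[ea _].
  apply: eq_exist => /=; rewrite -(val_inj ez : z = z') -ea {ea} in h' *.
  move: h h' => /(congr1 val)/=; rewrite val_tcast /= => h /(congr1 val)/=.
  rewrite val_tcast /= => h'.
  case/tupleP: x ex h => x1 x; case/tupleP: x => x2 x; rewrite (tuple0 x).
  case/tupleP: x' h' => x1' x'; case/tupleP: x' => x2' x'; rewrite (tuple0 x').
  case/tupleP: a => a1 a; rewrite (tuple0 a) /= /tnth /=.
  move=> [-> hy'] ex [e1 hy]; rewrite -{}e1 in ex *.
  (* The first entries of the two triples now agree, so cancelling them in [ex] identifies the
     middle ones. *)
  rewrite -(mulgI _ _ _ ex) in hy' *.
  by rewrite (val_inj (etrans (esym hy) hy') : y = y').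
- move=> [[p q] /= h].
  case/tupleP: p h => p1 p; case/tupleP: p => p2 p; rewrite (tuple0 p).
  case/tupleP: q => q1 q; case/tupleP: q => q2 q; rewrite (tuple0 q) => h.
  have hpq : p1 * p2 = q1 * q2 by case: (congr1 val h).
  pose A := tensSpan (oppSpan M) I.
  pose B := castSpan (addnA 1%N 1%N 1%N) erefl (tensSpan I M).
  (* The triple (q1, q1^-1 p1, p2) is forced: it starts with q1, ends with p2, and its first two
     entries multiply to p1. *)
  have k : leg1 (([tuple q1; q1^-1 * p1], [tuple p2]) : apex A)
    = leg0 (([tuple q1], [tuple q1^-1 * p1; p2]) : apex B).
    by apply: val_inj; rewrite /= val_tcast.
  exists (pullPair k); apply: (@compSpan_eq _ _ _ _ (oppSpan M) M) => /=.
  congr (_, _); apply: val_inj; rewrite /= /tnth /=.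
    by rewrite mulVKg.
  by rewrite -mulgA hpq mulKg.
Qed.

End Frobenius.

(* Otherwise [/=] unfolds [castHom] at [erefl], out of reach of [castHom_cls]. *)
Local Arguments castHom : simpl never.

Theorem mainTheorem9 (G : groupType) :
  let A : TSpan G := 1%N in
  exists (nabla : hom (tens A A) A) (n : hom tunit A)
         (Delta : hom A (tens A A)) (e : hom A tunit),
    [/\ spanOf nabla (mulSpan G),
        spanOf n (unitSpan G),
        spanOf Delta (oppSpan (mulSpan G)),
        spanOf e (oppSpan (unitSpan G))
      & isCommFrobenius nabla n Delta e].
Proof.
pose M := mulSpan G; pose N := unitSpan G; pose I := idSpan G 1.
exists (cls (isTSpan_mul G)), (cls (isTSpan_unit G)),
  (cls (isTSpan_opp (isTSpan_mul G))), (cls (isTSpan_opp (isTSpan_unit G))).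
split; [exact: isoSpan_refl.. | ].
split.
- split; rewrite /=; toSpans; apply: prodPreserving_iso; prodPreservingTac.
- split; rewrite /=; toSpans.
  (* Coassociativity has a composite on both sides, so its right side must first be written as an
     opposite too. *)
  + apply: isoSpan_trans _ (opp_comp_span _ (tensSpan M I)).
    apply: (@isoSpan_opp_cast_comp _ _ _ _ _ _ _ _ M (tensSpan I M)).
    by apply: prodPreserving_iso; prodPreservingTac.
  + apply: (@isoSpan_opp_cast_comp _ _ _ _ _ _ _ _ M (tensSpan N I) I).
    by apply: prodPreserving_iso; prodPreservingTac.
  + apply: (@isoSpan_opp_cast_comp _ _ _ _ _ _ _ _ M (tensSpan I N) I).
    by apply: prodPreserving_iso; prodPreservingTac.
- rewrite /=; toSpans; exact: frob_left_span.
- rewrite /=; toSpans.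
  (* With the cast on the inner factor, the left side is the opposite of the left side of the first
     law, while Delta nabla is its own opposite. *)
  apply: isoSpan_trans (comp_cast_span _ _ _) _.
  apply: isoSpan_trans (isoSpan_sym (opp_comp_span
    (castSpan _ _ (tensSpan I M)) (tensSpan (oppSpan M) I))) _.
  exact: isoSpan_trans (isoSpan_opp (frob_left_span G))
    (opp_comp_span (oppSpan M) M).
- rewrite /=; toSpans; apply: prodPreserving_iso; prodPreservingTac.
- rewrite /=; toSpans; apply: twist_comp_opp.
  apply: prodPreserving_iso; prodPreservingTac.
Qed.
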